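(* For fixed $n\ge1$, suppose $X^n$ is generated according to $P_{\theta_n}$ with $\theta_n\in\Theta_n$ and choose the uniform prior on $\Theta_n$. For given $0<a<1/2$, define $k=\lceil an\rceil$. Then the $k$-enlargement $C(X^n)$ of a credible set $D(X^n)$ of level $1-\gamma$ is a confidence set of confidence level $$P_{\theta_n}\bigl(\theta_n\in C(X^n)\bigr)\ \ge\ 1-\frac{1}{2(1-\gamma)}\Bigl(\frac{e}{a}\,\rho(p_n,q_n)^{n/2}\Bigr)^{an}\Bigl(1-\frac{e}{a}\,\rho(p_n,q_n)^{n/2}\Bigr)^{-1}.$$
   Context: Stochastic block model with two communities: for $n\ge1$ and $0\le m\le\lfloor n/2\rfloor$ let $\Theta_{n,m}=\{\theta_n\in\{0,1\}^n:\sum_i\theta_{n,i}=m\}$, except that for even $n$ and $m=n/2$, $\Theta_{n,n/2}=\{\theta_n\in\{0,1\}^n:\sum_i\theta_{n,i}=n/2,\ \theta_{n,1}=0\}$. Let $\Theta_n=\bigcup_{m=0}^{\lfloor n/2\rfloor}\Theta_{n,m}$; it has $2^{n-1}$ elements. Let $p_n,q_n\in[0,1]$. Under $P_{\theta_n}$ the observed random graph $X^n=\{X_{ij}:1\le i<j\le n\}\in\mathscr{X}_n=\{0,1\}^{\{(i,j):1\le i<j\le n\}}$ has independent edges with $P_{\theta_n}(X_{ij}=1)=Q_{ij}(\theta_n)$, where $Q_{ij}(\theta_n)=p_n$ if $\theta_{n,i}=\theta_{n,j}$ and $Q_{ij}(\theta_n)=q_n$ if $\theta_{n,i}\ne\theta_{n,j}$.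 Its probability mass function is $p_{\theta_n}(x^n)=\prod_{i<j}Q_{ij}(\theta_n)^{x_{ij}}(1-Q_{ij}(\theta_n))^{1-x_{ij}}$ (with $0^0=1$). The uniform prior $\Pi_n$ gives mass $2^{-(n-1)}$ to each element of $\Theta_n$; the corresponding posterior is $\Pi(A\mid X^n)=\sum_{\theta\in A}p_{\theta}(X^n)\big/\sum_{\theta'\in\Theta_n}p_{\theta'}(X^n)$ for $A\subset\Theta_n$ (defined whenever the denominator is positive, which holds $P_{\theta_n}$-almost surely for each $\theta_n\in\Theta_n$). The prior predictive distribution is $P^{\Pi_n}(X^n\in A)=2^{-(n-1)}\sum_{\theta\in\Theta_n}P_\theta(X^n\in A)$. A credible set of credible level $1-\gamma$ ($0\le\gamma<1$) is a data-dependent subset $D(X^n)\subset\Theta_n$ (a map $x^n\mapsto D(x^n)$) with $\Pi(D(X^n)\mid X^n)\ge1-\gamma$, $P^{\Pi_n}$-almost surely; in case $\gamma=0$, $D(X^n)$ is the support of the posterior. A confidence set of confidence level $1-\alpha$ ($0<\alpha<1$) is given by a ($\theta_n$-independent) set-valued map $x^n\mapsto C(x^n)\subset\Theta_n$ with $P_{\theta_n}(\theta_n\in C(X^n))\ge1-\alpha$. For $\theta_n,\eta_n\in\Theta_n$: $h(\theta_n,\eta_n)=\sum_i|\theta_{n,i}-\eta_{n,i}|$ and $k(\theta_n,\eta_n)=\min\{h(\theta_n,\eta_n),\,n-h(\theta_n,\eta_n)\}$. For a non-negative integer $k$, the $k$-enlargement of $D(X^n)$ is $C(X^n)=\{\theta_n\in\Theta_n:\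 \exists\,\eta_n\in D(X^n),\ k(\theta_n,\eta_n)\le k\}$. $\rho(p,q)=p^{1/2}q^{1/2}+(1-p)^{1/2}(1-q)^{1/2}$ is the Hellinger affinity between two Bernoulli distributions with parameters $p$ and $q$.
   Formalization: The formal theorem adds the hypothesis (e/a)ρ(p_n,q_n)^{n/2} < 1; if this quantity equals 1 the stated bound is undefined, and if it exceeds 1 (e.g. p_n = q_n) the right-hand side is greater than 1, so the claim is false. *)

(* Defs.v *)
From mathcomp Require Import all_boot all_order all_algebra.
From mathcomp Require Import reals sequences exp.

Set Implicit Arguments.
Unset Strict Implicit.
Unset Printing Implicit Defensive.

Import Order.TTheory GRing.Theory Num.Theory.

Local Open Scope ring_scope.

Notation labelling n := {ffun 'I_n -> bool}.

(* In the balanced case n = 2m a labelling and its complement both have m ones,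
   so the representative whose first label is 0 is selected. *)
Definition Theta_of_size (n m : nat) : {set labelling n} :=
  [set theta : labelling n |
    ((\sum_i theta i)%N == m) &&
    ((~~ odd n && (m == n./2)) ==>
       [forall i : 'I_n, (val i == 0%N) ==> ~~ theta i])].

Definition Theta (n : nat) : {set labelling n} :=
  \bigcup_(m < (n./2).+1) Theta_of_size n m.

Definition edge (n : nat) := {e : 'I_n * 'I_n | (e.1 < e.2)%N}.

Notation graph n := {ffun edge n -> bool}.

Definition hamming (n : nat) (theta eta : labelling n) : nat :=
  (\sum_i (theta i (+) eta i))%N.

Definition kdist (n : nat) (theta eta : labelling n) : nat :=
  minn (hamming theta eta) (n - hamming theta eta).

Definition enlargement (n k : nat) (D : graph n -> {set labelling n})
    (x : graph n) : {set labelling n} :=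
  [set theta in Theta n | [exists eta in D x, (kdist theta eta <= k)%N]].

Definition edge_prob (R : realType) (n : nat) (p q : R) (theta : labelling n)
    (e : edge n) : R :=
  if theta (val e).1 == theta (val e).2 then p else q.

Definition sbm_pmf (R : realType) (n : nat) (p q : R) (theta : labelling n)
    (x : graph n) : R :=
  \prod_(e : edge n) (edge_prob p q theta e ^+ x e
                      * (1 - edge_prob p q theta e) ^+ (1 - x e)).

Definition sbm_prob (R : realType) (n : nat) (p q : R) (theta : labelling n)
    (A : {set graph n}) : R :=
  \sum_(x in A) sbm_pmf p q theta x.

Definition prior_predictive (R : realType) (n : nat) (p q : R)
    (A : {set graph n}) : R :=
  2 ^- n.-1 * \sum_(theta in Theta n) sbm_prob p q theta A.

(* Posterior for the uniform prior.  It is meaningful only where the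
   denominator is positive; elsewhere the quotient evaluates to 0, and such x
   form a set of prior predictive probability 0. *)
Definition posterior (R : realType) (n : nat) (p q : R)
    (A : {set labelling n}) (x : graph n) : R :=
  (\sum_(theta in A) sbm_pmf p q theta x)
  / (\sum_(theta in Theta n) sbm_pmf p q theta x).

Definition posterior_support (R : realType) (n : nat) (p q : R)
    (x : graph n) : {set labelling n} :=
  [set theta in Theta n | 0 < posterior p q [set theta] x].

Definition predictive_as (R : realType) (n : nat) (p q : R)
    (E : {set graph n}) : Prop :=
  prior_predictive p q (~: E) = 0.

Definition credible_set (R : realType) (n : nat) (p q gamma : R)
    (D : graph n -> {set labelling n}) : Prop :=
  [/\ forall x, D x \subset Theta n,
      predictive_as p q [set x | 1 - gamma <= posterior p q (D x) x]
    & gamma = 0 -> predictive_as p q [set x | D x == posterior_support p q x]].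

Definition hellinger_affinity (R : realType) (p q : R) : R :=
  Num.sqrt p * Num.sqrt q + Num.sqrt (1 - p) * Num.sqrt (1 - q).

(* Main.v *)
Require Import Defs.
From mathcomp Require Import all_boot all_order all_algebra.
From mathcomp Require Import reals sequences exp.
From mathcomp Require Import lra zify.

Set Implicit Arguments.
Unset Strict Implicit.
Unset Printing Implicit Defensive.

Import Order.TTheory GRing.Theory Num.Theory.

Local Open Scope ring_scope.

(** If theta lies outside the enlargement C(x), then every element of D(x) is
    at distance more than k from theta, so the posterior gives mass at least
    1 - gamma to the set [far] of those labellings.  By Markov's inequality,
    P_theta(theta \notin C) is at most (1 - gamma)^-1 times the P_theta-expected
    posterior mass of [far].

    That expectation is a sum over eta in [far].  Keeping only the terms of
    theta and eta in the denominator of Bayes' formula, the summand of eta is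
    at most the sum over x of p_theta p_eta / (p_theta + p_eta), which the
    arithmetic-geometric mean inequality bounds by half the Hellinger affinity
    of P_theta and P_eta ([sum_pmf_posterior_le]); this is the origin of the
    factor 1/2.  The affinity of product measures is a product over the edges.
    An edge contributes rho(p, q) when exactly one of its endpoints is
    labelled differently by theta and eta, and 1 otherwise.  With h
    disagreements there are h (n - h) edges of the first kind ([card_cut]),
    and with j = k(theta, eta) <= n / 2 this number is j (n - j) >= j n / 2.

    Theta_n contains no labelling together with its complement, so at most
    'C(n, j) of its elements are at distance j from theta
    ([card_Theta_sphere]), and 'C(n, j) <= (e n / j)^j <= (e / a)^j as soon as
    j >= a n ([bin_le_expR]).  The expectation is therefore at most half of
    the geometric tail of ratio r = (e / a) rho^(n / 2) starting at
    k + 1 > a n ([sum_affinity_far_le]). *)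

(** * Square roots and the Bernoulli affinity *)

Section BernoulliAffinity.
Variable R : realType.
Implicit Types p q : R.

Lemma hellinger_affinity_ge0 p q : 0 <= hellinger_affinity p q.
Proof. by rewrite addr_ge0 // mulr_ge0 // sqrtr_ge0. Qed.

Lemma hellinger_affinityC p q :
  hellinger_affinity p q = hellinger_affinity q p.
Proof. by rewrite /hellinger_affinity mulrC [X in _ + X]mulrC. Qed.

Lemma hellinger_affinity_refl p : 0 <= p <= 1 -> hellinger_affinity p p = 1.
Proof.
move=> /andP[p0 p1].
by rewrite /hellinger_affinity -!expr2 !sqr_sqrtr ?subr_ge0 // addrC subrK.
Qed.

Lemma sqrtrM_le (x y : R) : 0 <= x -> 0 <= y ->
  Num.sqrt x * Num.sqrt y <= (x + y) / 2.
Proof.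
move=> x0 y0; rewrite -{2}(sqr_sqrtr x0) -{2}(sqr_sqrtr y0).
by have := sqr_ge0 (Num.sqrt x - Num.sqrt y); nra.
Qed.

Lemma hellinger_affinity_le1 p q :
  0 <= p <= 1 -> 0 <= q <= 1 -> hellinger_affinity p q <= 1.
Proof.
move=> /andP[p0 p1] /andP[q0 q1].
have := sqrtrM_le p0 q0.
have : Num.sqrt (1 - p) * Num.sqrt (1 - q) <= ((1 - p) + (1 - q)) / 2.
  by apply: sqrtrM_le; rewrite subr_ge0.
rewrite /hellinger_affinity; lra.
Qed.

Lemma sqrtr_prod (I : finType) (F : I -> R) : (forall i, 0 <= F i) ->
  Num.sqrt (\prod_i F i) = \prod_i Num.sqrt (F i).
Proof.
move=> F0.
suff [] : Num.sqrt (\prod_i F i) = \prod_i Num.sqrt (F i) /\ 0 <= \prod_i F i.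
  by [].
apply: (big_rec2 (fun x y => Num.sqrt y = x /\ 0 <= y)) => [|i x y _ [<- y0]].
  by rewrite sqrtr1.
by rewrite sqrtrM // mulr_ge0.
Qed.

(** The harmonic mean is at most the geometric mean; when x + y = 0 the left
    side is 0 because 0^-1 = 0. *)
Lemma mul_div_add_le (x y : R) : 0 <= x -> 0 <= y ->
  x * y / (x + y) <= Num.sqrt (x * y) / 2.
Proof.
move=> x0 y0; have [s0|s0] := eqVneq (x + y) 0.
  by rewrite s0 invr0 mulr0 divr_ge0 // sqrtr_ge0.
have s_gt0 : 0 < x + y by rewrite lt0r s0 addr_ge0.
rewrite ler_pdivrMr // -{1}(sqr_sqrtr (mulr_ge0 x0 y0)).
have := sqrtrM_le x0 y0; rewrite -sqrtrM //.
have := sqrtr_ge0 (x * y).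
set t := Num.sqrt (x * y); nra.
Qed.

End BernoulliAffinity.

(** * Affinity between two block models *)

Section PMF.
Variables (R : realType) (n : nat) (p q : R).
Hypotheses (hp : 0 <= p <= 1) (hq : 0 <= q <= 1).
Implicit Types (theta eta : labelling n) (x : graph n).

Lemma edge_prob_itv theta e : 0 <= edge_prob p q theta e <= 1.
Proof. by rewrite /edge_prob; case: ifP. Qed.

Lemma edge_factor_ge0 theta e (b : bool) :
  0 <= edge_prob p q theta e ^+ b * (1 - edge_prob p q theta e) ^+ (1 - b).
Proof.
have /andP[e0 e1] := edge_prob_itv theta e.
by rewrite mulr_ge0 // exprn_ge0 // subr_ge0.
Qed.

Lemma sbm_pmf_ge0 theta x : 0 <= sbm_pmf p q theta x.
Proof. by apply: prodr_ge0 => e _; apply: edge_factor_ge0. Qed.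

Lemma sum_sbm_pmf theta : \sum_x sbm_pmf p q theta x = 1.
Proof.
rewrite -(bigA_distr_bigA (fun e (b : bool) =>
  edge_prob p q theta e ^+ b * (1 - edge_prob p q theta e) ^+ (1 - b))).
rewrite big1 // => e _.
by rewrite big_bool /= subnn subn0 !expr0 !expr1 mulr1 mul1r addrC subrK.
Qed.

Definition disagreement theta eta : {set 'I_n} :=
  [set i | theta i (+) eta i].

Definition cut (A : {set 'I_n}) : {set edge n} :=
  [set e | ((val e).1 \in A) (+) ((val e).2 \in A)].

(** Whether an edge joins equal or unequal labels changes between theta and
    eta exactly when one of its two labels is flipped. *)
Lemma affinity_edge_prob theta eta e :
  hellinger_affinity (edge_prob p q theta e) (edge_prob p q eta e) =
  if e \in cut (disagreement theta eta) then hellinger_affinity p q else 1.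
Proof.
rewrite !inE /edge_prob.
case: (theta _) (theta _) (eta _) (eta _) => [] [] [] [] //=;
  by rewrite ?hellinger_affinity_refl // hellinger_affinityC.
Qed.

(** The edges are independent, so the sum over graphs of a product over edges
    factorizes into the affinities of the individual edges. *)
Lemma sum_sqrt_sbm_pmf theta eta :
  \sum_x Num.sqrt (sbm_pmf p q theta x * sbm_pmf p q eta x) =
  hellinger_affinity p q ^+ #|cut (disagreement theta eta)|.
Proof.
pose F e (b : bool) : R :=
  Num.sqrt (edge_prob p q theta e ^+ b * (1 - edge_prob p q theta e) ^+ (1 - b))
  * Num.sqrt (edge_prob p q eta e ^+ b * (1 - edge_prob p q eta e) ^+ (1 - b)).
transitivity (\sum_(x : graph n) \prod_e F e (x e)).
  apply: eq_bigr => x _; rewrite sqrtrM ?sbm_pmf_ge0 // /sbm_pmf.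
  by rewrite !sqrtr_prod ?big_split // => e; apply: edge_factor_ge0.
rewrite -(bigA_distr_bigA F) -prodr_const [RHS]big_mkcond; apply: eq_bigr => e _.
rewrite -affinity_edge_prob big_bool /F /=.
by rewrite subnn subn0 !expr0 !expr1 !mulr1 !mul1r.
Qed.

End PMF.

(** * Counting edges and labellings *)

(** Each edge of the cut, oriented from its endpoint in A to the other one, is
    a unique element of the product of A and its complement. *)
Lemma card_cut (n : nat) (A : {set 'I_n}) :
  #|cut A| = (#|A| * (n - #|A|))%N.
Proof.
pose f (e : edge n) :=
  if (val e).1 \in A then val e else ((val e).2, (val e).1).
have f_inj : injective f.
  move=> [[i j] /= ij] [[k l] /= kl]; rewrite /f /=.
  by case: ifP => _; case: ifP => _ [ik jl]; apply: val_inj => /=;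
    subst => //; move: (ltn_trans ij kl); rewrite ltnn.
have -> : (n - #|A|)%N = #|~: A| by rewrite [RHS]cardsCs setCK card_ord.
rewrite -(card_imset _ f_inj) -cardsX; apply: eq_card => -[i j].
rewrite in_setX in_setC; apply/imsetP/andP.
  move=> [[[k l] /= kl]]; rewrite inE /f /=.
  by case: ifP => kA; rewrite ?kA /= => lA [-> ->]; rewrite ?kA.
move=> [iA jA]; have : i != j by apply: contraNneq jA => <-.
rewrite neq_ltn => /orP[ij|ji].
  by exists (exist _ (i, j) ij); rewrite ?inE /f /= iA // (negbTE jA).
by exists (exist _ (j, i) ji); rewrite ?inE /f /= (negbTE jA) ?iA.
Qed.

Lemma hammingE (n : nat) (theta eta : labelling n) :
  hamming theta eta = #|disagreement theta eta|.
Proof.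
rewrite /hamming -sum1_card [RHS]big_mkcond; apply: eq_bigr => i _.
by rewrite inE; case: (_ (+) _).
Qed.

Definition complement (n : nat) (theta : labelling n) : labelling n :=
  [ffun i => ~~ theta i].

(** A labelling and its complement have n ones in total, hence n / 2 each if
    both have at most n / 2; the convention on the first label in the balanced
    case then rules out one of the two. *)
Lemma Theta_complement (n : nat) (theta : labelling n) : (0 < n)%N ->
  theta \in Theta n -> complement theta \notin Theta n.
Proof.
move=> n0 /bigcupP[[m /= m_le] _]; rewrite inE => /andP[/eqP theta_m first0].
apply/negP => /bigcupP[[l /= l_le] _]; rewrite inE => /andP[/eqP theta_l first0'].
have : (m + l = n)%N.
  rewrite -theta_m -theta_l -big_split /= -[RHS]card_ord -sum1_card.
  by apply: eq_bigr => i _; rewrite ffunE; case: (theta i).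
have := odd_double_half n => nE mln.
have [m_half l_half n_even] : [/\ m = n./2, l = n./2 & ~~ odd n] by split; lia.
move: first0 first0'; rewrite m_half l_half eqxx n_even /=.
move=> /forallP/(_ (Ordinal n0)) /= th0 /forallP/(_ (Ordinal n0)) /=.
by rewrite ffunE th0.
Qed.

(** At distance j from theta, either the disagreement set or its complement has
    j elements.  Sending eta to that set identifies only complementary
    labellings, so the map is injective on Theta n. *)
Lemma card_Theta_sphere (n j : nat) (theta : labelling n) : (0 < n)%N ->
  (#|[set eta in Theta n | kdist theta eta == j]| <= 'C(n, j))%N.
Proof.
move=> n0.
have -> : 'C(n, j) = #|[set B : {set 'I_n} | #|B| == j]|.
  by rewrite card_draws card_ord.
pose A eta := disagreement theta eta.
pose f eta := if #|A eta| == j then A eta else ~: A eta.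
have A_inj : injective A.
  move=> eta eta' /setP E; apply/ffunP => i; move: (E i); rewrite !inE.
  by case: (theta i); case: (eta i); case: (eta' i).
have A_compl eta : A (complement eta) = ~: A eta.
  by apply/setP => i; rewrite !inE ffunE addbN.
have f_inj : {in Theta n &, injective f}.
  move=> eta eta' etaT eta'T; rewrite /f.
  case: ifP => _; case: ifP => _; rewrite -?A_compl => /A_inj E.
  - by [].
  - by move: etaT; rewrite E (negbTE (Theta_complement _ eta'T)).
  - by move: eta'T; rewrite -E (negbTE (Theta_complement _ etaT)).
  - by apply/ffunP => i; move/ffunP/(_ i): E; rewrite !ffunE => /negb_inj.
rewrite -(card_in_imset (f := f)); last first.
  by move=> eta eta'; rewrite !inE => /andP[? _] /andP[? _]; apply: f_inj.
apply/subset_leq_card/subsetP => _ /imsetP[eta + ->].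
rewrite !inE /kdist hammingE -/(A eta) => /andP[_ /eqP kj].
rewrite /f; case: ifP => // /eqP Aj; rewrite cardsCs setCK card_ord.
by apply/eqP; move: kj Aj; lia.
Qed.

(** * Binomial coefficients and geometric tails *)

Lemma leq_bin_expn (n j : nat) : ('C(n, j) * j`! <= n ^ j)%N.
Proof.
rewrite bin_ffact.
elim: j n => [//|j IH] [|n]; first by rewrite ffact0n.
rewrite ffactnS expnS leq_mul2l (leq_trans (IH n)) ?orbT //.
by case: (j) => // j'; rewrite leq_exp2r.
Qed.

Section RealBounds.
Variable R : realType.

(** The term j^j / j! is one of the terms of the exponential series at j. *)
Lemma expn_le_expR_fact (j : nat) : (j ^ j)%:R <= expR 1 ^+ j * (j`!)%:R :> R.
Proof.
case: j => [|j]; first by rewrite fact0 expn0 expr0 mulr1.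
rewrite -expRM_natl mulr1 -ler_pdivrMr ?ltr0n ?fact_gt0 // natrX.
apply: le_trans (expR_ge1Dxn j (ler0n R j.+1)).
by rewrite lerDr.
Qed.

Lemma bin_le_expR (a : R) (n j : nat) : 0 < a -> (0 < j)%N ->
  a * n%:R <= j%:R -> ('C(n, j))%:R <= (expR 1 / a) ^+ j.
Proof.
move=> a0 j0 anj; have jj0 : 0 < (j ^ j)%:R :> R by rewrite ltr0n expn_gt0 j0.
rewrite -(ler_pM2r jj0); apply: le_trans (_ : (expR 1 * n%:R) ^+ j <= _).
  rewrite exprMn -natrX.
  apply: le_trans (_ : expR 1 ^+ j * ('C(n, j) * j`!)%:R <= _); last first.
    by rewrite ler_wpM2l ?exprn_ge0 ?expR_ge0 // ler_nat leq_bin_expn.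
  by rewrite natrM mulrCA ler_wpM2l // expn_le_expR_fact.
rewrite natrX -exprMn lerXn2r ?nnegrE ?mulr_ge0 ?invr_ge0 ?expR_ge0 ?(ltW a0) //.
by rewrite -mulrA ler_wpM2l ?expR_ge0 // mulrC ler_pdivlMr // mulrC.
Qed.

Lemma geometric_tail_le (r : R) (m N : nat) : 0 <= r < 1 ->
  \sum_(m <= j < N) r ^+ j <= r ^+ m / (1 - r).
Proof.
move=> /andP[r0 r1]; have r1' : 0 < 1 - r by rewrite subr_gt0.
rewrite ler_pdivlMr // mulr_suml; have [Nm|/ltnW mN] := leqP N m.
  by rewrite big_geq // exprn_ge0.
under eq_bigr do rewrite mulrBr mulr1 -exprSr -opprB.
by rewrite sumrN telescope_sumr // opprB lerBlDr lerDl exprn_ge0.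
Qed.

(** Positivity of t matters at r = 0, since 0 `^ 0 = 1 while 0 ^+ m = 0 for
    m > 0. *)
Lemma exp_le_powR (r t : R) (m : nat) : 0 <= r <= 1 -> 0 < t -> t <= m%:R ->
  r ^+ m <= r `^ t.
Proof.
move=> /andP[r0 r1] t0 tm; have [->|rn0] := eqVneq r 0.
  have m0 : (0 < m)%N by rewrite -(ltr0n R) (lt_le_trans t0).
  by rewrite expr0n -[m]prednK //= powR_ge0.
by rewrite -powR_mulrn // ger_powR // lt0r rn0 r0.
Qed.

End RealBounds.

(** * Posterior mass away from the truth *)

Lemma kdist_half (n : nat) (theta eta : labelling n) :
  ((kdist theta eta).*2 <= n)%N.
Proof. by rewrite /kdist; lia. Qed.

Lemma kdist_refl (n : nat) (theta : labelling n) : kdist theta theta = 0%N.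
Proof.
by rewrite /kdist /hamming big1 ?min0n // => i _; rewrite addbb.
Qed.

Section PosteriorMass.
Variables (R : realType) (n : nat) (p q : R).
Hypotheses (hn : (0 < n)%N) (hp : 0 <= p <= 1) (hq : 0 <= q <= 1).

Local Notation rho := (hellinger_affinity p q).

(** Writing j for the distance, the exponent is j (n - j) with n - j >= n / 2;
    since rho <= 1 it may be lowered to j n / 2. *)
Lemma affinity_le_kdist (theta eta : labelling n) :
  rho ^+ #|cut (disagreement theta eta)| <=
  (rho `^ (n%:R / 2)) ^+ kdist theta eta.
Proof.
have rho0 : 0 <= rho := hellinger_affinity_ge0 p q.
have rho1 : rho <= 1 by apply: hellinger_affinity_le1.
(* In terms of s = sqrt rho both sides are natural powers of s. *)
set s := Num.sqrt rho.
have s0 : 0 <= s := sqrtr_ge0 rho.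
have s1 : s <= 1 by rewrite -sqrtr1 ler_sqrt.
rewrite mulrC powRrM powR12_sqrt // powR_mulrn // -/s.
rewrite -(sqr_sqrtr rho0) -/s -!exprM card_cut -hammingE.
have hE : (hamming theta eta <= n)%N.
  by rewrite hammingE -[X in (_ <= X)%N]card_ord max_card.
apply: ler_wiXn2l => //.
rewrite /kdist /minn; case: ltnP; nia.
Qed.

(** Grouping the labellings by their distance j to theta, the sphere of radius
    j > k contributes at most r ^+ j. *)
Lemma sum_affinity_far_le (a : R) (k : nat) (theta : labelling n) :
  0 < a -> a * n%:R <= k%:R ->
  let r := expR 1 / a * rho `^ (n%:R / 2) in r < 1 ->
  \sum_(eta in Theta n | (k < kdist theta eta)%N)
    rho ^+ #|cut (disagreement theta eta)|
  <= r `^ (a * n%:R) * (1 - r)^-1.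
Proof.
move=> a0 ank r r1.
have r0 : 0 <= r by rewrite !mulr_ge0 ?invr_ge0 ?powR_ge0 ?expR_ge0 ?(ltW a0).
have kdn eta : (kdist theta eta < n.+1)%N.
  by have := kdist_half theta eta; lia.
apply: le_trans (_ : \sum_(k.+1 <= j < n.+1) r ^+ j <= _); last first.
  apply: le_trans (geometric_tail_le _ _ _) _; first by rewrite r0.
  rewrite ler_wpM2r ?invr_ge0 ?subr_ge0 ?(ltW r1) // exp_le_powR ?r0 ?ltW //.
    by rewrite mulr_gt0 // ltr0n.
  by rewrite (le_lt_trans ank) // ltr_nat.
rewrite (partition_big (fun eta => Ordinal (kdn eta)) (fun j => (k < j)%N));
  last by move=> eta /andP[].
rewrite big_geq_mkord; apply: ler_sum => j kj.
apply: le_trans (_ : \sum_(eta in [set eta in Theta n | kdist theta eta == j])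
    (rho `^ (n%:R / 2)) ^+ j <= _).
  apply: le_trans (_ : \sum_(eta | ((eta \in Theta n) &&
      (k < kdist theta eta)%N) && (Ordinal (kdn eta) == j))
      (rho `^ (n%:R / 2)) ^+ j <= _).
    by apply: ler_sum => eta /andP[_ /eqP <-] /=; apply: affinity_le_kdist.
  rewrite le_eqVlt; apply/orP; left; apply/eqP; apply: eq_bigl => eta.
  rewrite inE -val_eqE /= -andbA; congr (_ && _).
  by case: eqP => [->|_]; rewrite ?andbF ?kj.
rewrite sumr_const -[_ *+ _]mulr_natl exprMn ler_wpM2r ?exprn_ge0 ?powR_ge0 //.
apply: le_trans (_ : ('C(n, j))%:R <= _).
  by rewrite ler_nat card_Theta_sphere.
apply: bin_le_expR => //; first by apply: leq_ltn_trans kj.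
by rewrite (le_trans ank) // ler_nat ltnW.
Qed.

Lemma posterior_ge0 A (x : graph n) : 0 <= posterior p q A x.
Proof. by rewrite divr_ge0 // sumr_ge0 // => eta _; apply: sbm_pmf_ge0. Qed.

Lemma posterior_subset (A B : {set labelling n}) (x : graph n) :
  A \subset B -> posterior p q A x <= posterior p q B x.
Proof.
move=> AB; rewrite ler_wpM2r //.
  by rewrite invr_ge0 sumr_ge0 // => eta _; apply: sbm_pmf_ge0.
rewrite [leRHS](big_setID A) /= (setIidPr AB) lerDl.
by apply: sumr_ge0 => eta _; apply: sbm_pmf_ge0.
Qed.

(** A null set of the prior predictive is null under every P_theta, because
    the prior gives positive mass to each theta; this is what carries the
    almost sure credibility of D over to P_theta. *)
Lemma predictive_as_pmf0 (E : {set graph n}) (theta : labelling n) x :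
  predictive_as p q E -> theta \in Theta n -> x \notin E ->
  sbm_pmf p q theta x = 0.
Proof.
rewrite /predictive_as /prior_predictive => /eqP.
rewrite mulf_eq0 invr_eq0 expf_eq0 pnatr_eq0 andbF /= => /eqP pr0 thT xE.
have ge0 eta : 0 <= sbm_prob p q eta (~: E).
  by apply: sumr_ge0 => y _; apply: sbm_pmf_ge0.
have := psumr_eq0P (fun eta _ => ge0 eta) pr0 thT.
move=> /(psumr_eq0P (fun y _ => sbm_pmf_ge0 hp hq theta y)); apply.
by rewrite inE.
Qed.

(** Only theta and eta are kept in the normalizing sum of the posterior; they
    are distinct because theta is outside A, which is what yields the factor
    1/2. *)
Lemma sum_pmf_posterior_le (theta : labelling n) (A : {set labelling n}) :
  theta \in Theta n -> A \subset Theta n -> theta \notin A ->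
  \sum_x sbm_pmf p q theta x * posterior p q A x <=
  2^-1 * \sum_(eta in A) rho ^+ #|cut (disagreement theta eta)|.
Proof.
move=> thT AT thA.
under [X in _ <= _ * X]eq_bigr do rewrite -(sum_sqrt_sbm_pmf hp hq).
rewrite exchange_big mulr_sumr /=; apply: ler_sum => x _.
rewrite /posterior mulrA !mulr_sumr mulr_suml; apply: ler_sum => eta etaA.
have f0 := @sbm_pmf_ge0 R n p q hp hq.
have [->|th0] := eqVneq (sbm_pmf p q theta x) 0.
  by rewrite !mul0r sqrtr0 mulr0.
rewrite [leRHS]mulrC.
refine (le_trans _ (mul_div_add_le (f0 theta x) (f0 eta x))).
have th_gt0 : 0 < sbm_pmf p q theta x by rewrite lt0r th0 f0.
have s_gt0 : 0 < sbm_pmf p q theta x + sbm_pmf p q eta x by rewrite ltr_wpDr.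
have two_le : sbm_pmf p q theta x + sbm_pmf p q eta x <=
    \sum_(zeta in Theta n) sbm_pmf p q zeta x.
  have etaT := subsetP AT _ etaA.
  rewrite (bigD1 theta) //= lerD2l (bigD1 eta) /=; last first.
    by rewrite etaT; apply: contraNneq thA => <-.
  by rewrite lerDl sumr_ge0.
rewrite ler_wpM2l ?mulr_ge0 // lef_pV2 // posrE.
by apply: lt_le_trans two_le.
Qed.

End PosteriorMass.

Theorem proposition5p7 (R : realType) (n : nat) (hn : (1 <= n)%N)
  (p q : R) (hp : 0 <= p <= 1) (hq : 0 <= q <= 1)
  (gamma : R) (hgamma : 0 <= gamma < 1)
  (D : graph n -> {set labelling n}) (hD : credible_set p q gamma D)
  (a : R) (ha : 0 < a < 1 / 2)
  (k : nat) (hk : k%:Z = Num.ceil (a * n%:R))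
  (theta : labelling n) (htheta : theta \in Theta n)
  (hratio : expR 1 / a * hellinger_affinity p q `^ (n%:R / 2) < 1) :
  sbm_prob p q theta [set x | theta \in enlargement k D x] >=
  1 - 1 / (2 * (1 - gamma))
      * (expR 1 / a * hellinger_affinity p q `^ (n%:R / 2)) `^ (a * n%:R)
      * (1 - expR 1 / a * hellinger_affinity p q `^ (n%:R / 2))^-1.
Proof.
have /andP[_ gamma1] := hgamma; have /andP[a0 _] := ha.
have g0 : 0 < 1 - gamma by rewrite subr_gt0.
have ank : a * n%:R <= k%:R.
  by have := ceil_ge (a * n%:R); rewrite -hk.
have [DT Dlevel _] := hD.
have f0 := sbm_pmf_ge0 hp hq theta.
pose far := [set eta in Theta n | (k < kdist theta eta)%N].
(* Markov's inequality, one graph at a time. *)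
have missed x : x \notin [set x | theta \in enlargement k D x] ->
    sbm_pmf p q theta x <=
    (1 - gamma)^-1 * (sbm_pmf p q theta x * posterior p q far x).
  move=> xC.
  have D_far : D x \subset far.
    apply/subsetP => eta etaD; rewrite inE (subsetP (DT x)) //= ltnNge.
    apply: contra xC => close; rewrite !inE htheta; apply/existsP.
    by exists eta; rewrite etaD.
  rewrite mulrC ler_pdivlMr //.
  have [xE|xE] := boolP (x \in [set x | 1 - gamma <= posterior p q (D x) x]).
    rewrite ler_wpM2l //; move: xE; rewrite inE => /le_trans; apply.
    exact: posterior_subset.
  by rewrite (predictive_as_pmf0 hp hq Dlevel htheta xE) !mul0r.
set r := _ / a * _ in hratio *.
have theta_far : theta \notin far by rewrite inE kdist_refl andbF.
have far_Theta : far \subset Theta n.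
  by apply/subsetP => eta; rewrite inE => /andP[].
have far_le := sum_pmf_posterior_le hp hq htheta far_Theta theta_far.
rewrite /sbm_prob.
have total := sum_sbm_pmf p q theta.
rewrite (bigID (mem [set x | theta \in enlargement k D x])) /= in total.
rewrite -[X in X - _]total lerBlDr lerD2l.
apply: le_trans (_ : (1 - gamma)^-1 *
    \sum_x sbm_pmf p q theta x * posterior p q far x <= _).
  rewrite mulr_sumr; apply: le_trans (ler_sum _ missed) _.
  rewrite [leRHS](bigID (mem [set x | theta \in enlargement k D x])) /= lerDr.
  by apply: sumr_ge0 => x _; rewrite mulr_ge0 ?invr_ge0 ?(ltW g0) // mulr_ge0 // posterior_ge0.
rewrite mul1r invfM [2^-1 * _]mulrC -!mulrA ler_pM2l ?invr_gt0 //.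
apply: le_trans far_le _; rewrite ler_pM2l ?invr_gt0 //.
rewrite (eq_bigl (fun eta => (eta \in Theta n) && (k < kdist theta eta)%N)).
  exact: sum_affinity_far_le.
by move=> eta; rewrite inE.
Qed.
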